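(* There exists an absolute constant $\alpha>0$ such that for any Banach space $X$ the following assertions are equivalent. (1) $X$ is not K-convex. (2) For all $\theta>0$ and all $n=1,2,\dots$ there is a Walsh-Paley martingale $\{M_k\}_0^n$ with values in the closed unit ball $B_X$ such that $$\inf_{1\le k\le n}\inf_{\omega\in\Omega_n}\|dM_k(\omega)\|\ge 1-\theta\quad\text{and}\quad \inf_{\omega\in\Omega_n}\mathbb{E}_\varepsilon\Big\|\sum_{k=1}^n\varepsilon_k\,dM_k(\omega)\Big\|\ge\alpha n.$$ (3) There is a constant $c=c(X)>0$ such that $RUMD_n(X)\ge cn$ for $n=1,2,\dots$.
   Context: Banach spaces are over $\mathbb{K}$ (the real or complex scalars). A Banach space is not K-convex if and only if it contains the spaces $\ell_1^n$ uniformly. Let $\Omega_n=\{-1,1\}^n$ with the uniform probability $\mu_n(\{\omega\})=2^{-n}$, let $\mathcal{F}_0=\{\emptyset,\Omega_n\}$ and let $\mathcal{F}_k$ be the $\sigma$-algebra generated by the coordinates $\omega_1,\dots,\omega_k$. A Walsh-Paley martingale $\{M_k\}_0^n$ with values in $X$ is an $X$-valued martingale over $(\Omega_n,\mu_n)$ with respect to $\{\mathcal{F}_k\}_0^n$ ($M_0$ is not assumed to be $0$ unless stated); $dM_k:=M_k-M_{k-1}$ for $k\ge1$. Let also $D_n=\{-1,1\}^n$ with uniform probability $P_n$; $\mathbb{E}_\varepsilon$ is the expectation over $\varepsilon\in D_n$ and $\mathbb{E}_{\varepsilon,\omega}$ the expectation with respect to $P_n\times\mu_n$. $RUMD_n(X)$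 is the infimum of all $c>0$ such that $$\Big(\mathbb{E}_{\varepsilon,\omega}\Big\|\sum_{k=1}^n\varepsilon_k\,dM_k(\omega)\Big\|^2\Big)^{1/2}\le c\,\big(\mathbb{E}_\omega\|M_n(\omega)\|^2\big)^{1/2}$$ for all Walsh-Paley martingales $\{M_k\}_0^n$ with values in $X$ and $M_0=0$. *)

(* Defs.v *)
From HB Require Import structures.
From mathcomp Require Import all_boot all_order all_algebra.
From mathcomp Require Import complex.
From mathcomp Require Import all_classical all_reals all_analysis.
Set Implicit Arguments.
Unset Strict Implicit.
Unset Printing Implicit Defensive.
Import Order.TTheory GRing.Theory Num.Theory.
Import numFieldNormedType.Exports.
Local Open Scope classical_set_scope.
Local Open Scope ring_scope.

Variant scalar_kind := RealScalars | ComplexScalars.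

Definition scalars (R : realType) (s : scalar_kind) : numFieldType :=
  match s with
  | RealScalars => R
  | ComplexScalars => R[i]
  end.

(* Norms of modules over K : numFieldType take their values in K.  They are
   transported to R here; nothing is lost on norms, which are real. *)
Definition to_real (R : realType) (s : scalar_kind) : scalars R s -> R :=
  match s return scalars R s -> R with
  | RealScalars => id
  | ComplexScalars => @complex.Re R
  end.

Definition rabs (R : realType) (s : scalar_kind) (a : scalars R s) : R :=
  to_real `|a|.

Definition rnorm (R : realType) (s : scalar_kind)
  (X : normedModType (scalars R s)) (x : X) : R := to_real `|x|.

Definition l1norm (R : realType) (s : scalar_kind) (n : nat)
  (a : 'rV[scalars R s]_n) : R := \sum_(i < n) rabs (a ord0 i).

(* A linear embedding T of l_1^n with ||T|| ||T^-1|| <= lambda, rescaled so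
   that ||T^-1|| <= 1; lambda is independent of n. *)
Definition contains_l1n_uniformly (R : realType) (s : scalar_kind)
  (X : normedModType (scalars R s)) : Prop :=
  exists lambda : R, forall n : nat, (0 < n)%N ->
    exists T : {linear 'rV[scalars R s]_n -> X},
      forall a, l1norm a <= rnorm (T a) <= lambda * l1norm a.

(* K-convexity is taken in the form "X does not contain the spaces l_1^n
   uniformly". *)
Definition K_convex (R : realType) (s : scalar_kind)
  (X : normedModType (scalars R s)) : Prop := ~ contains_l1n_uniformly X.

(* {-1,1}^n, a boolean b standing for the sign (-1) ^+ b. *)
Definition cube (n : nat) : finType := {ffun 'I_n -> bool}.

(* Expectation for the uniform probability on a nonempty finite type; on
   cube n * cube n this is the product of the uniform probabilities. *)
Definition expect (R : realType) (T : finType) (f : T -> R) : R :=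
  #|T|%:R^-1 * \sum_(t : T) f t.

Definition coord_sigma (n k : nat) : set_system (cube n) :=
  <<s [set A | exists (i : 'I_n) (b : bool),
                 (i < k)%N /\ A = [set w : cube n | w i = b]] >>.

(* M k is meaningful for k <= n only.  The last clause is
   E(M_(k+1) | F_k) = M_k, the common factor 2^-n of both integrals over A
   being cancelled. *)
Definition walsh_paley_martingale (R : realType) (s : scalar_kind)
  (X : normedModType (scalars R s)) (n : nat) (M : nat -> cube n -> X) : Prop :=
  (forall k, (k <= n)%N ->
     forall U : set X, open U -> coord_sigma k (M k @^-1` U)) /\
  (forall k, (k < n)%N -> forall A : set (cube n), coord_sigma k A ->
     \sum_(w | w \in A) M k.+1 w = \sum_(w | w \in A) M k w).

(* Indices are shifted: for k in {0,..,n-1} this is dM_(k+1). *)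
Definition mdiff (R : realType) (s : scalar_kind)
  (X : normedModType (scalars R s)) (n : nat) (M : nat -> cube n -> X)
  (k : 'I_n) (w : cube n) : X := M k.+1 w - M k w.

Definition signed_sum (R : realType) (s : scalar_kind)
  (X : normedModType (scalars R s)) (n : nat) (M : nat -> cube n -> X)
  (e w : cube n) : X := \sum_(k < n) (-1) ^+ (e k) *: mdiff M k w.

Definition RUMD (R : realType) (s : scalar_kind)
  (X : normedModType (scalars R s)) (n : nat) : \bar R :=
  ereal_inf [set c%:E | c in [set c : R | 0 < c /\
    forall M : nat -> cube n -> X,
      walsh_paley_martingale M -> (forall w, M 0%N w = 0) ->
      Num.sqrt (expect (fun ew : cube n * cube n =>
                  rnorm (signed_sum M ew.1 ew.2) ^+ 2))
      <= c * Num.sqrt (expect (fun w => rnorm (M n w) ^+ 2))]].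

(* Main.v *)
(* (1) => (2). By James' distortion argument X contains almost isometric copies
   of l_1 indexed by the cube, that is, of L_1 of the cube, where the densities
   prod_(i <= k) (1 + w_i v_i) form a martingale of unit vectors whose
   differences have norm one.  At a given v the moduli of its differences
   double until they vanish, so their maximum, which the average over random
   signs dominates, is at least half of their sum.
   (2) => (3). Subtract M_0 and use Jensen's inequality.
   (3) => (1). Let t_n be the best constant in
   E |sum z_i x_i|^2 <= t_n n sum |x_i|^2, with z_i independent uniform signs,
   or fourth roots of unity in the complex case.  Then RUMD_n <= n sqrt(8 t_n),
   and t_(nm) <= t_n t_m.  If some t_n < 1, then t_(n^k) -> 0, against (3).
   Otherwise, for each n, there are x_i for which all the |sum z_i x_i| are
   almost maximal, and convexity gives a copy of l_1^n. *)
Require Import Defs.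
From HB Require Import structures.
From mathcomp Require Import all_boot all_order all_algebra.
From mathcomp Require Import complex.
From mathcomp Require Import all_classical all_reals all_analysis.
From mathcomp Require Import zify ring lra.
Set Implicit Arguments.
Unset Strict Implicit.
Unset Printing Implicit Defensive.
Import Order.TTheory GRing.Theory Num.Theory.
Import numFieldNormedType.Exports.
Local Open Scope classical_set_scope.
Local Open Scope ring_scope.

(** * Real-valued moduli and norms over either scalar field *)

Section Scalars.
Variables (R : realType) (s : scalar_kind).
Implicit Types (r : R) (a b : scalars R s).

Definition of_real : R -> scalars R s :=
  match s return R -> scalars R s with
  | RealScalars => id
  | ComplexScalars => @real_complex R
  end.

Lemma to_realK a : 0 <= a -> of_real (to_real a) = a.
Proof.
rewrite /of_real /to_real; case: s a => // -[x y].
by rewrite lecE /= => /andP[/eqP -> _].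
Qed.

Lemma of_realD r1 r2 : of_real (r1 + r2) = of_real r1 + of_real r2.
Proof. by rewrite /of_real; case: s => //; rewrite rmorphD. Qed.

Lemma of_realM r1 r2 : of_real (r1 * r2) = of_real r1 * of_real r2.
Proof. by rewrite /of_real; case: s => //; rewrite rmorphM. Qed.

Lemma of_real0 : of_real 0 = 0.
Proof. by rewrite /of_real; case: s. Qed.

Lemma of_real1 : of_real 1 = 1.
Proof. by rewrite /of_real; case: s. Qed.

Lemma of_realN r : of_real (- r) = - of_real r.
Proof. by rewrite /of_real; case: s => //; rewrite rmorphN. Qed.

Lemma le_of_real r1 r2 : (of_real r1 <= of_real r2) = (r1 <= r2).
Proof. by rewrite /of_real; case: s => //; exact: lecR. Qed.

Lemma of_real_inj : injective of_real.
Proof. by move=> x y e; apply/le_anti; rewrite -!le_of_real e lexx. Qed.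

Lemma of_real_rabs a : of_real (rabs a) = `|a|.
Proof. exact: to_realK. Qed.

Lemma rabs_ge0 a : 0 <= rabs a.
Proof. by rewrite -le_of_real of_real0 of_real_rabs. Qed.

Lemma rabsM a b : rabs (a * b) = rabs a * rabs b.
Proof. by apply: of_real_inj; rewrite of_realM !of_real_rabs normrM. Qed.

Lemma rabsN a : rabs (- a) = rabs a.
Proof. by rewrite /rabs normrN. Qed.

Lemma rabs_ge0_of_real r : 0 <= r -> rabs (of_real r) = r.
Proof.
by move=> r0; apply: of_real_inj; rewrite of_real_rabs ger0_norm// -of_real0 le_of_real.
Qed.

Lemma rabs_of_real r : rabs (of_real r) = `|r|.
Proof.
have [r0|/ltW r0] := leP 0 r; first by rewrite rabs_ge0_of_real// ger0_norm.
by rewrite -rabsN -of_realN rabs_ge0_of_real ?oppr_ge0// ler0_norm.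
Qed.

Lemma rabs1 : rabs (1 : scalars R s) = 1.
Proof. by rewrite -of_real1 rabs_of_real normr1. Qed.

Lemma rabs0 : rabs (0 : scalars R s) = 0.
Proof. by rewrite -of_real0 rabs_of_real normr0. Qed.

Lemma rabs_sign (b : bool) : rabs ((-1) ^+ b : scalars R s) = 1.
Proof. by case: b; rewrite ?expr1 ?rabsN rabs1. Qed.

Lemma rabsX a n : rabs (a ^+ n) = rabs a ^+ n.
Proof. by elim: n => [|n IHn]; rewrite ?rabs1// !exprS rabsM IHn. Qed.

Variable X : normedModType (scalars R s).
Implicit Types x y : X.

Lemma of_real_rnorm x : of_real (rnorm x) = `|x|.
Proof. exact: to_realK. Qed.

Lemma rnorm_ge0 x : 0 <= rnorm x.
Proof. by rewrite -le_of_real of_real0 of_real_rnorm. Qed.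

Lemma rnorm0 : rnorm (0 : X) = 0.
Proof. by apply: of_real_inj; rewrite of_real_rnorm of_real0 normr0. Qed.

Lemma rnormN x : rnorm (- x) = rnorm x.
Proof. by rewrite /rnorm normrN. Qed.

Lemma rnormD x y : rnorm (x + y) <= rnorm x + rnorm y.
Proof. by rewrite -le_of_real of_realD !of_real_rnorm ler_normD. Qed.

Lemma rnormB x y : rnorm (x - y) <= rnorm x + rnorm y.
Proof. by rewrite (le_trans (rnormD _ _))// rnormN. Qed.

Lemma rnorm_subr x y : rnorm x - rnorm y <= rnorm (x + y).
Proof.
by rewrite lerBlDr -(rnormN y) (le_trans _ (rnormD _ _))// addrK.
Qed.

Lemma rnormZ a x : rnorm (a *: x) = rabs a * rnorm x.
Proof.
by apply: of_real_inj; rewrite of_realM of_real_rabs !of_real_rnorm normrZ.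
Qed.

Lemma rnorm_sum (I : Type) (r : seq I) (P : pred I) (F : I -> X) :
  rnorm (\sum_(i <- r | P i) F i) <= \sum_(i <- r | P i) rnorm (F i).
Proof.
elim/big_ind2 : _ => //; first by rewrite rnorm0.
by move=> x1 r1 x2 r2 h1 h2; rewrite (le_trans (rnormD _ _))// lerD.
Qed.

End Scalars.

(** * Roots of unity as substitutes for signs *)

(* One group of unimodular scalars serves both fields: with kappa = 1 it is
   {1, -1}, with kappa = 'i it is the group of fourth roots of unity. *)
Definition unimod (R : realType) (s : scalar_kind) (kappa : scalars R s)
  (p : bool * bool) : scalars R s := (-1) ^+ p.1 * kappa ^+ p.2.

(** The group law on exponents: [sg] records whether [kappa ^+ 2] is 1 or -1, and the conjunction is
    the carry produced by [kappa * kappa]. *)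
Definition root_mul (sg : bool) (p q : bool * bool) : bool * bool :=
  (p.1 (+) q.1 (+) (sg && p.2 && q.2), p.2 (+) q.2).

Lemma unimodM (R : realType) s (kappa : scalars R s) (sg : bool) p q :
  kappa ^+ 2 = (-1) ^+ sg ->
  unimod kappa (root_mul sg p q) = unimod kappa p * unimod kappa q.
Proof.
case: p q => [p1 p2] [q1 q2]; rewrite /unimod /root_mul /= mulrACA => k2.
rewrite !signr_addb -!mulrA; do 2 congr (_ * _).
by case: p2 q2 => [] []; rewrite /= ?andbF ?andbT ?expr0 ?expr1 ?mul1r ?mulr1// -k2.
Qed.

Lemma root_mulI sg p : injective (root_mul sg p).
Proof.
by case: sg p => -[[] []] [[] []] [[] []].
Qed.

Lemma rabs_unimod (R : realType) s (kappa : scalars R s) p :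
  rabs kappa = 1 -> rabs (unimod kappa p) = 1.
Proof. by move=> k1; rewrite rabsM rabs_sign rabsX k1 expr1n mulr1. Qed.

(** Take [kappa] to be 1 or ['i]. The third property bounds sign averages by averages over roots.
    For the last, a complex number lies within 45 degrees of some fourth root of unity, and 2
    sin(pi/8) < 4/5. *)
Lemma exists_rotation (R : realType) s : exists (kappa : scalars R s) (sg : bool),
  [/\ kappa ^+ 2 = (-1) ^+ sg, rabs kappa = 1,
      2 <= rabs (1 + kappa) ^+ 2 &
      forall a : scalars R s, exists p,
        rabs (a - of_real s (rabs a) * unimod kappa p) <= 4 / 5 * rabs a].
Proof.
case: s.
  exists 1, false; split; first by rewrite expr1n.
  - exact: rabs1.
  - rewrite /rabs/= ger0_norm; last exact: addr_ge0.
    by rewrite expr2; lra.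
  move=> a; exists (a < 0, false).
  rewrite /unimod /rabs /= mulr1 [`|a| * _]mulrC -numEsign ?num_real// subrr normr0.
  by apply: mulr_ge0 => //; lra.
have rabsE (a : R[i]) : rabs (a : scalars R ComplexScalars) =
    Num.sqrt (complex.Re a ^+ 2 + complex.Im a ^+ 2) by rewrite /rabs normc_def.
exists ('i%C), true; split.
- by rewrite sqr_i expr1.
- by rewrite rabsE/= expr0n/= add0r expr1n sqrtr1.
- rewrite rabsE/= sqr_sqrtr; last by rewrite addr_ge0// sqr_ge0.
  rewrite !expr2; lra.
move=> a; set r := rabs a.
have r0 : 0 <= r := rabs_ge0 a.
have r2 : r ^+ 2 = complex.Re a ^+ 2 + complex.Im a ^+ 2.
  by rewrite /r rabsE sqr_sqrtr// addr_ge0// sqr_ge0.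
pose e (p : bool * bool) : R[i] := (a : R[i]) - r%:C%C * ((-1) ^+ p.1 * 'i%C ^+ p.2).
suff [p hp] : exists p : bool * bool,
    complex.Re (e p) ^+ 2 + complex.Im (e p) ^+ 2 <= (4 / 5 * r) ^+ 2.
  exists p; rewrite -ler_sqr ?nnegrE ?rabs_ge0//; last by lra.
  by rewrite -[_ - _]/(e p) rabsE sqr_sqrtr// addr_ge0// sqr_ge0.
rewrite /e; clear e.
clearbody r.
have key (u v : R) : 0 <= u -> u ^+ 2 + v ^+ 2 = r ^+ 2 -> v ^+ 2 <= u ^+ 2 ->
    (u - r) ^+ 2 + v ^+ 2 <= (4 / 5 * r) ^+ 2.
  move=> u0 uv vu.
  (* The dominant coordinate is at least [r / sqrt 2], hence at least [17/25 * r]. The squared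
     distance is [2 r^2 - 2 u r], and 2 (1 - 17/25) = (4/5)^2. *)
  have hu : 17 / 25 * r <= u.
    have r17 : 0 <= 17 / 25 * r by lra.
    rewrite -ler_sqr ?nnegrE//.
    have -> : (17 / 25 * r) ^+ 2 = 289 / 625 * r ^+ 2 by field.
    rewrite -uv; have := sqr_ge0 u; lra.
  have : 0 <= r * (u - 17 / 25 * r) by rewrite mulr_ge0// subr_ge0.
  nra.
case: a r2 => x y /= r2.
have [xy|/ltW yx] := leP (y ^+ 2) (x ^+ 2).
  have [x0|/ltW x0] := leP 0 x.
    exists (false, false); rewrite [leLHS](_ : _ = (x - r) ^+ 2 + y ^+ 2) ?key//.
    by rewrite /=; ring.
  exists (true, false).
  rewrite [leLHS](_ : _ = (- x - r) ^+ 2 + y ^+ 2) ?key ?oppr_ge0 ?sqrrN//.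
  by rewrite /=; ring.
have [y0|/ltW y0] := leP 0 y.
  exists (false, true).
  rewrite [leLHS](_ : _ = (y - r) ^+ 2 + x ^+ 2) ?key// 1?addrC//.
  by rewrite /=; ring.
exists (true, true).
rewrite [leLHS](_ : _ = (- y - r) ^+ 2 + x ^+ 2) ?key ?oppr_ge0 ?sqrrN// 1?addrC//.
by rewrite /=; ring.
Qed.

(** * The coordinate filtration of the cube *)

(* g_sigma_algebraType requires a pointed carrier. *)
HB.instance Definition _ (n : nat) :=
  isPointed.Build {ffun 'I_n -> bool} [ffun=> false].

Section Cube.
Variable n : nat.
Implicit Types (k : nat) (w v : cube n) (A : set (cube n)).

Definition agree k w v : bool := [forall i : 'I_n, (i < k)%N ==> (w i == v i)].

Lemma agreeP k w v : reflect (forall i : 'I_n, (i < k)%N -> w i = v i) (agree k w v).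
Proof.
by apply: (iffP forall_inP) => h i /h; [move/eqP | move=> ->].
Qed.

Lemma agree_refl k w : agree k w w.
Proof. exact/agreeP. Qed.

Lemma agree_sym k w v : agree k w v = agree k v w.
Proof. by apply: eq_forallb => i; rewrite eq_sym. Qed.

Lemma agree_trans k v w u : agree k w v -> agree k v u -> agree k w u.
Proof. by move=> /agreeP wv /agreeP vu; apply/agreeP => i ik; rewrite wv// vu. Qed.

Lemma agree_le k k' w v : (k <= k')%N -> agree k' w v -> agree k w v.
Proof.
by move=> kk' /agreeP wv; apply/agreeP => i ik; apply: wv; rewrite (leq_trans ik).
Qed.

Lemma agreeS (i : 'I_n) w v : agree i.+1 w v = agree i w v && (w i == v i).
Proof.
apply/agreeP/andP => [h|[/agreeP h /eqP e] j].
  by split; [apply/agreeP => j ji; apply: h; rewrite ltnW | rewrite h].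
by rewrite ltnS leq_eqVlt => /orP[/eqP/val_inj -> //|/h].
Qed.

Definition flip (i : 'I_n) w : cube n := [ffun j => w j (+) (j == i)].

Lemma flipK i : involutive (flip i).
Proof. by move=> w; apply/ffunP => j; rewrite !ffunE addbK. Qed.

Lemma flip_eq i w : flip i w i = ~~ w i.
Proof. by rewrite ffunE eqxx addbT. Qed.

Lemma flip_neq i j w : j != i -> flip i w j = w j.
Proof. by rewrite ffunE => /negbTE ->; rewrite addbF. Qed.

Lemma agree_flip k (i : 'I_n) w : (k <= i)%N -> agree k w (flip i w).
Proof.
move=> ki; apply/agreeP => j jk; rewrite flip_neq//.
by apply: contraTneq (leq_trans jk ki) => ->; rewrite ltnn.
Qed.

Lemma agree_flipr (i : 'I_n) w v : agree i w (flip i v) = agree i w v.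
Proof.
apply/idP/idP => h; apply: agree_trans h _; last exact: agree_flip.
by rewrite agree_sym agree_flip.
Qed.

Lemma sum_flip (V : nmodType) (P : pred (cube n)) (f : cube n -> V) (i : 'I_n) :
  (forall w, P (flip i w) = P w) ->
  \sum_(w | P w) (f w + f (flip i w)) = (\sum_(w | P w) f w) *+ 2.
Proof.
move=> Pf; rewrite big_split/= mulr2n; congr (_ + _).
rewrite [RHS](reindex_inj (inv_inj (flipK i)))/=.
by apply: eq_bigl => w; rewrite Pf.
Qed.

(** The classes of [agree k] are the atoms of F_k. Saturated sets form a sigma-algebra containing
    the generators; conversely a saturated set is a finite union of cylinders. *)
Lemma coord_sigmaP k A :
  coord_sigma k A <-> (forall w v, agree k w v -> A w -> A v).
Proof.
split=> [kA|hA].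
  apply: (kA [set B | forall w v, agree k w v -> B w -> B v]); split; first split => //.
  - move=> B hB w v wv [_ Bw]; split=> // Bv; apply: Bw.
    by apply: hB Bv; rewrite agree_sym.
  - by move=> F hF w v wv [m _ Fw]; exists m => //; exact: hF wv Fw.
  by move=> _ [i [b [ik ->]]] w v /agreeP wv /= <-; rewrite wv.
pose G := [set A : set {ffun 'I_n -> bool} | exists (i : 'I_n) (b : bool),
                 (i < k)%N /\ A = [set w : cube n | w i = b]].
have -> : A = \bigcup_(w in A) \bigcap_(i in [set i : 'I_n | (i < k)%N])
    [set v : cube n | v i = w i].
  apply/seteqP; split=> [w Aw|v [w Aw h]]; first by exists w.
  by apply: hA Aw; apply/agreeP => i ik; rewrite (h i).
apply: (@fin_bigcup_measurable _ (g_sigma_algebraType G)) => [|w _].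
  exact: finite_finset.
apply: (@fin_bigcap_measurable _ (g_sigma_algebraType G)) => [|i ik].
  exact: finite_finset.
by apply: sub_sigma_algebra; exists i, (w i).
Qed.

End Cube.

Lemma of_realMn (R : realType) s (r : R) m : of_real s (r *+ m) = of_real s r *+ m.
Proof. by elim: m => [|m IHm]; rewrite ?of_real0// !mulrS of_realD IHm. Qed.

Lemma rabs_nat (R : realType) s m : rabs (m%:R : scalars R s) = m%:R.
Proof. by rewrite -(of_real1 R s) -of_realMn rabs_of_real normr_nat. Qed.

Lemma rnormMn (R : realType) s (X : normedModType (scalars R s)) (x : X) m :
  rnorm (x *+ m) = rnorm x *+ m.
Proof.
by apply: (@of_real_inj R s); rewrite of_realMn !of_real_rnorm normrMn.
Qed.

(** * Walsh-Paley martingales described pointwise by coordinate flips *)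

Section Martingales.
Variables (R : realType) (s : scalar_kind) (X : normedModType (scalars R s)).
Variable n : nat.
Implicit Types (M : nat -> cube n -> X).

(** Every set of F_i is invariant under [flip i], so its points can be paired and the conditional
    expectation reduces to the mean over each pair. *)
Lemma walsh_paley_intro M :
  (forall k w v, (k <= n)%N -> agree k w v -> M k w = M k v) ->
  (forall (i : 'I_n) w, M i.+1 w + M i.+1 (flip i w) = M i w *+ 2) ->
  walsh_paley_martingale M.
Proof.
move=> Mk MS; split=> [k kn U oU|k kn A /coord_sigmaP kA].
  by apply/coord_sigmaP => w v wv; rewrite /= (Mk k w v).
pose i := Ordinal kn.
have Ai w : (flip i w \in A) = (w \in A).
  apply/idP/idP; rewrite !inE; apply: kA; last exact: agree_flip.
  by rewrite agree_sym agree_flip.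
(* Both sides are doubled so that each point of [A] can be summed together with its flip. *)
apply: (@scalerI _ X 2%:R); first by rewrite pnatr_eq0.
rewrite !scaler_nat -(@sum_flip n X (fun w => w \in A) _ i Ai) -sumrMnl.
by apply: eq_bigr => w _; rewrite (MS i).
Qed.

(** Points of X are closed, so measurability applied to the complement of the value [M k w] shows
    that this value is taken on the whole atom of [w]. *)
Lemma walsh_paley_agree M k w v : walsh_paley_martingale M ->
  (k <= n)%N -> agree k w v -> M k w = M k v.
Proof.
move=> [Mm _] kn wv; apply: contrapT => neq.
have oU : open (~` [set M k w]).
  apply: closed_openC; apply: accessible_closed_set1.
  exact: hausdorff_accessible (@norm_hausdorff _ _).
have /coord_sigmaP/(_ v w) := Mm k kn _ oU.
by rewrite agree_sym => /(_ wv); apply => // /esym.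
Qed.

(** Test the martingale identity on the atom of F_i around [w]: there [M i] is constant and [M i.+1]
    takes one value on each of the two halves exchanged by [flip i]. *)
Lemma walsh_paley_flip M (i : 'I_n) w : walsh_paley_martingale M ->
  M i.+1 w + M i.+1 (flip i w) = M i w *+ 2.
Proof.
move=> wpM; have [_ /(_ i (ltn_ord i) [set v | agree i w v])] := wpM.
have Ai v : (v \in [set v | agree i w v]) = agree i w v.
  by apply/idP/idP; rewrite inE.
rewrite !(eq_bigl _ _ Ai) => /(_ _)/wrap[].
  by apply/coord_sigmaP => v u vu wv; exact: agree_trans wv vu.
rewrite [RHS](eq_bigr (fun=> M i w)) => [|v wv]; last first.
  by apply/esym/walsh_paley_agree => //; exact: ltnW.
move/(congr1 (fun x => x *+ 2)); rewrite -(@sum_flip _ _ _ _ i); last first.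
  by move=> v; rewrite agree_flipr.
rewrite (eq_bigr (fun=> M i.+1 w + M i.+1 (flip i w))) => [|v wv]; last first.
  (* Depending on its coordinate [i], [v] lies in the half of [w] or in the other one; the two
     summands are then in the same order or swapped. *)
  have [vi|vi] := eqVneq (v i) (w i).
    congr (_ + _); apply: (walsh_paley_agree wpM) => //.
      by rewrite agreeS agree_sym wv vi eqxx.
    by rewrite agreeS agree_flipr agree_sym agree_flipr wv !flip_eq vi eqxx.
  have vi' : v i = ~~ w i by case: (v i) (w i) vi => [] [].
  rewrite addrC; congr (_ + _); apply: (walsh_paley_agree wpM) => //.
    by rewrite agreeS agree_sym agree_flipr wv flip_eq vi' negbK eqxx.
  by rewrite agreeS agree_flipr agree_sym wv flip_eq vi' eqxx.
rewrite !sumr_const -mulrnA mulnC mulrnA.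
set c := #|_|; have c0 : c%:R != 0 :> scalars R s.
  rewrite pnatr_eq0 -lt0n; apply/card_gt0P; exists w; exact: agree_refl.
by rewrite -[LHS]scaler_nat -[RHS]scaler_nat => /(scalerI c0).
Qed.

(** Jensen's inequality for the squared norm, one step at a time and by induction on [n - k]. *)
Lemma walsh_paley_rnorm M k : walsh_paley_martingale M -> (k <= n)%N ->
  \sum_w rnorm (M k w) ^+ 2 <= \sum_w rnorm (M n w) ^+ 2.
Proof.
move=> wpM; elim: {k}(n - k)%N {-2}k (erefl (n - k)%N) => [|m IHm] k nk kn.
  by have -> : k = n by lia.
have ltkn : (k < n)%N by lia.
apply: le_trans (IHm k.+1 _ ltkn); last by lia.
pose i := Ordinal ltkn.
(* Of the factor 4 on the right, one 2 is absorbed by pairing [w] with its flip, the other is that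
   of [(a + b)^2 <= 2 (a^2 + b^2)]. *)
rewrite -(@ler_pMn2r _ 4)// [leRHS](mulrnA _ 2 2) -(@sum_flip n _ predT _ i)//.
rewrite -!sumrMnl; apply: ler_sum => w _.
have -> : rnorm (M k w) ^+ 2 *+ 4 = rnorm (M k w *+ 2) ^+ 2.
  by rewrite rnormMn -mulr_natr -[_ *+ 2]mulr_natr exprMn -natrX.
rewrite -(walsh_paley_flip i w wpM) /=.
have /(lerXn2r 2) := rnormD (M k.+1 w) (M k.+1 (flip i w)).
rewrite !nnegrE rnorm_ge0 addr_ge0 ?rnorm_ge0// => /(_ isT isT)/le_trans; apply.
have := sqr_ge0 (rnorm (M k.+1 w) - rnorm (M k.+1 (flip i w))).
by rewrite !expr2; lra.
Qed.

End Martingales.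

(** * Almost isometric copies of l_1 by James' argument *)

Lemma exists_expr_lt (R : realType) (q e : R) : 0 <= q < 1 -> 0 < e ->
  exists k : nat, q ^+ k < e.
Proof.
move=> /andP[q0 q1] e0; have q1' : `|q| < 1 by rewrite ger0_norm.
have [k _ hk] := cvgr_lt _ (cvg_expr q1') _ e0.
by exists k; apply: hk => /=.
Qed.

Section L1.
Variables (R : realType) (s : scalar_kind) (X : normedModType (scalars R s)).

Definition l1_lower_bound (I : finType) (q : R) (x : I -> X) : Prop :=
  forall a : I -> scalars R s,
    q * \sum_i rabs (a i) <= rnorm (\sum_i a i *: x i).

Lemma l1norm_delta n (j : 'I_n) : l1norm (delta_mx ord0 j : 'rV[scalars R s]_n) = 1.
Proof.
rewrite /l1norm (bigD1 j)//= mxE !eqxx rabs1 big1 ?addr0// => i /negbTE ij.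
by rewrite mxE eqxx ij rabs0.
Qed.

(** Dividing the embedding by [lam] normalises the vectors instead of the inverse. Any finite index
    type is allowed, since products of types occur below. *)
Lemma contains_l1n_bound : contains_l1n_uniformly X ->
  exists2 q : R, 0 < q & forall I : finType, (0 < #|I|)%N ->
    exists x : I -> X, (forall i, rnorm (x i) <= 1) /\ l1_lower_bound q x.
Proof.
move=> [lam hlam].
have lam0 : 0 < lam.
  (* A unit vector of l_1^1 shows that the given constant is positive. *)
  have [T /(_ (delta_mx ord0 ord0))] := hlam 1%N isT.
  by rewrite l1norm_delta mulr1 => /andP[/le_trans/[apply]]; apply: lt_le_trans.
have lamV0 : 0 <= lam^-1 by rewrite invr_ge0 ltW.
exists lam^-1; rewrite ?invr_gt0// => I I0.
have [T hT] := hlam _ I0.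
exists (fun i => of_real s lam^-1 *: T (delta_mx ord0 (enum_rank i))); split=> [i|a].
  rewrite rnormZ rabs_ge0_of_real// ler_pdivrMl// mulr1.
  by have /andP[_] := hT (delta_mx ord0 (enum_rank i)); rewrite l1norm_delta mulr1.
pose v : 'rV[scalars R s]_#|I| := \row_j a (enum_val j).
have -> : \sum_i rabs (a i) = l1norm v.
  rewrite /l1norm (reindex _ (onW_bij _ (@enum_rank_bij I)))/=.
  by apply: eq_bigr => i _; rewrite mxE enum_rankK.
have -> : \sum_i a i *: (of_real s lam^-1 *: T (delta_mx ord0 (enum_rank i))) =
    of_real s lam^-1 *: T v.
  rewrite (row_sum_delta v) linear_sum scaler_sumr.
  rewrite [RHS](reindex _ (onW_bij _ (@enum_rank_bij I)))/=.
  by apply: eq_bigr => i _; rewrite mxE enum_rankK [T (_ *: _)]linearZ_LR !scalerA mulrC.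

rewrite rnormZ rabs_ge0_of_real// ler_pM2l ?invr_gt0//.
by have /andP[] := hT v.
Qed.

(** Induction on [k] with index type [I * J]: each row has a normalised combination of norm at most
    [q ^+ k]. Divided by [q ^+ k], these blocks are again in the unit ball, and the hypothesis on
    [I] gains another factor [q]. *)
Lemma james_block (I : finType) (q : R) : 0 < q ->
  (forall x : I -> X, (forall i, rnorm (x i) <= 1) ->
    exists a : I -> scalars R s,
      \sum_i rabs (a i) = 1 /\ rnorm (\sum_i a i *: x i) <= q) ->
  forall k, exists2 J : finType, (0 < #|J|)%N &
    forall x : J -> X, (forall j, rnorm (x j) <= 1) ->
    exists a : J -> scalars R s,
      \sum_j rabs (a j) = 1 /\ rnorm (\sum_j a j *: x j) <= q ^+ k.
Proof.
move=> q0 hI; elim=> [|k [J J0 hJ]].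
  exists 'I_1 => [|x hx]; first by rewrite card_ord.
  by exists (fun=> 1); rewrite !big_ord1 rabs1 scale1r.
have qk0 : 0 < q ^+ k by rewrite exprn_gt0.
have qVk0 : 0 <= q ^- k by rewrite invr_ge0 ltW.
(* Over an empty [I] no coefficients could have moduli summing to one; the zero family provides such
   coefficients. *)
have I0 : (0 < #|I|)%N.
  have [|a [sa _]] := hI (fun=> 0) _; first by move=> i; rewrite rnorm0.
  rewrite lt0n; apply: contra_eqN sa => /eqP/card0_eq I0.
  by rewrite big_pred0 ?(eq_sym 0) ?oner_eq0// => i; have := I0 i; rewrite !inE.
exists (I * J)%type => [|x hx]; first by rewrite card_prod muln_gt0 I0.
have hb i := hJ (fun j => x (i, j)) (fun j => hx (i, j)).
have [b hb'] := choice hb.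
have [|a [sa ha]] :=
    hI (fun i => of_real s (q ^- k) *: \sum_j b i j *: x (i, j)) _.
  move=> i; rewrite rnormZ rabs_ge0_of_real// ler_pdivrMl// mulr1.
  by case: (hb' i).
exists (fun p => a p.1 * b p.1 p.2); split.
  rewrite -(pair_bigA _ (fun i j => rabs (a i * b i j)))/= -sa.
  apply: eq_bigr => i _; rewrite -[RHS]mulr1 -(hb' i).1 mulr_sumr.
  by apply: eq_bigr => j _; rewrite rabsM.
rewrite (eq_bigr (fun p => (a p.1 * b p.1 p.2) *: x (p.1, p.2))) => [|[]//].
rewrite -(pair_bigA _ (fun i j => (a i * b i j) *: x (i, j)))/=.
have -> : \sum_i \sum_j (a i * b i j) *: x (i, j) = of_real s (q ^+ k) *:
    \sum_i a i *: (of_real s (q ^- k) *: \sum_j b i j *: x (i, j)).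
  rewrite scaler_sumr; apply: eq_bigr => i _.
  rewrite !scalerA mulrAC -of_realM divff ?gt_eqF// of_real1 mul1r scaler_sumr.
  by apply: eq_bigr => j _; rewrite scalerA.
by rewrite rnormZ rabs_ge0_of_real; [|exact: ltW]; rewrite exprSr ler_pM2l.
Qed.

(* James' distortion argument: if no family indexed by I is nearly isometric
   to the basis of l_1, blocking makes the lower constant decay geometrically. *)
Lemma james_distortion (I : finType) (q : R) : contains_l1n_uniformly X ->
  0 < q < 1 -> exists x : I -> X, (forall i, rnorm (x i) <= 1) /\ l1_lower_bound q x.
Proof.
move=> /contains_l1n_bound[q' q'0 hq'] /andP[q0 q1].
apply: contrapT => hI.
(* A vector violating the lower bound, rescaled to l_1 norm one, is the combination that
   [james_block] asks for. *)
have hblock (x : I -> X) : (forall i, rnorm (x i) <= 1) ->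
    exists a : I -> scalars R s,
      \sum_i rabs (a i) = 1 /\ rnorm (\sum_i a i *: x i) <= q.
  move=> hx; apply: contrapT => ha; apply: hI; exists x; split=> // a.
  have [a0|a0] := eqVneq (\sum_i rabs (a i)) 0.
    by rewrite a0 mulr0 rnorm_ge0.
  have {}a0 : 0 < \sum_i rabs (a i).
    by rewrite lt_def a0 sumr_ge0// => i _; exact: rabs_ge0.
  have aV0 : 0 <= (\sum_i rabs (a i))^-1 by rewrite invr_ge0 ltW.
  rewrite leNgt; apply/negP => lta; apply: ha.
  exists (fun i => of_real s (\sum_i rabs (a i))^-1 * a i); split.
    rewrite -(mulVf (lt0r_neq0 a0)) mulr_sumr; apply: eq_bigr => i _.
    by rewrite rabsM rabs_ge0_of_real.
  under eq_bigr do rewrite -scalerA.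
  rewrite -scaler_sumr rnormZ rabs_ge0_of_real//.
  by rewrite mulrC ler_pdivrMr// ltW.
(* The constant [q'] serves all index types, so a block with [q ^+ k < q'] is contradictory. *)
have [k qk] : exists k, q ^+ k < q'.
  by apply: exists_expr_lt; rewrite // ltW.
have [J J0 hJ] := james_block q0 hblock k.
have [x [x1 hx]] := hq' J J0; have [a [sa /(le_trans (hx a))]] := hJ x x1.
by rewrite sa mulr1 leNgt qk.
Qed.
End L1.

(** * Finite expectations and random signs *)

Section Expectation.
Variables (R : realType) (T : finType).
Implicit Types f g : T -> R.

Lemma le_expect f g : (forall t, f t <= g t) -> expect f <= expect g.
Proof. by move=> fg; rewrite ler_wpM2l ?invr_ge0// ler_sum. Qed.

Lemma expectZ (c : R) f : expect (fun t => c * f t) = c * expect f.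
Proof. by rewrite /expect -mulr_sumr mulrCA. Qed.

Lemma expectB f g : expect (fun t => f t - g t) = expect f - expect g.
Proof. by rewrite /expect sumrB mulrBr. Qed.

Lemma expect_sum (I : finType) (F : I -> T -> R) :
  expect (fun t => \sum_i F i t) = \sum_i expect (F i).
Proof. by rewrite /expect exchange_big/= mulr_sumr. Qed.

Lemma expect_cst (c : R) : (0 < #|T|)%N -> expect (fun _ : T => c) = c.
Proof.
by move=> T0; rewrite /expect sumr_const -[c *+ _]mulr_natl mulKf// pnatr_eq0 -lt0n.
Qed.

Lemma expect_ge0 f : (forall t, 0 <= f t) -> 0 <= expect f.
Proof. by move=> f0; rewrite mulr_ge0 ?invr_ge0 ?sumr_ge0. Qed.

Lemma sqr_expect_le f : (0 < #|T|)%N -> expect f ^+ 2 <= expect (fun t => f t ^+ 2).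
Proof.
move=> T0; have h t : 2 * expect f * f t - expect f ^+ 2 <= f t ^+ 2.
  by have := sqr_ge0 (f t - expect f); rewrite !expr2; lra.
apply: le_trans (le_expect h).
by rewrite expectB expectZ expect_cst// expr2; lra.
Qed.

End Expectation.

Lemma card_cube n : #|cube n| = (2 ^ n)%N.
Proof. by rewrite card_ffun card_bool card_ord. Qed.

Lemma card_cube_gt0 n : (0 < #|cube n|)%N.
Proof. by rewrite card_cube expn_gt0. Qed.

(** Pair [e] with its flip at [j]: with [u] the j-th term and [S] the rest, |u + S| + |-u + S| >= 2
    |u|. *)
Lemma expect_sign_ge (R : realType) n (c : 'I_n -> R) (j : 'I_n) :
  `|c j| <= expect (fun e : cube n => `|\sum_k (-1) ^+ e k * c k|).
Proof.
rewrite -[leLHS](@expect_cst _ (cube n))//; last exact: card_cube_gt0.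
rewrite ler_pM2l ?invr_gt0 ?ltr0n ?card_cube_gt0//.
rewrite -(@ler_pMn2r _ 2)// -!(@sum_flip n _ predT _ j)//.
apply: ler_sum => e _.
rewrite (bigD1 j)//= [X in _ <= _ + `|X|](bigD1 j)//= flip_eq.
rewrite [X in _ + `|_ + X|](eq_bigr (fun k => (-1) ^+ e k * c k)) => [|k kj]; last first.
  by rewrite flip_neq.
set S := \sum_(i < n | _) _; set u := (-1) ^+ e j * c j.
have -> : (-1) ^+ (~~ e j) * c j = - u.
  by rewrite /u; case: (e j); rewrite !mulN1r ?mul1r ?opprK.
have : `|u| = `|c j| by rewrite /u normrM normr_sign mul1r.
move=> <-; have := ler_normB (u + S) (- u + S).
have -> : u + S - (- u + S) = u *+ 2 by rewrite mulr2n; ring.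
by rewrite normrMn mulr2n.
Qed.

(** * The dyadic densities on the cube *)

Section DyadicMartingale.
Variables (R : realType) (n : nat).
Implicit Types (w v : cube n).

(* The density prod_(i < k) (1 + w_i v_i), divided by 2 ^ n. *)
Definition dyadic (k : nat) w v : R := 2 ^+ k / 2 ^+ n * (agree k w v)%:R.

Lemma dyadic_ge0 k w v : 0 <= dyadic k w v.
Proof. by rewrite mulr_ge0// divr_ge0// exprn_ge0. Qed.

Lemma dyadicS (i : 'I_n) w v :
  dyadic i.+1 w v = dyadic i w v * (2 * (w i == v i)%:R).
Proof.
rewrite /dyadic agreeS exprS -mulnb natrM; ring.
Qed.

Lemma dyadic_sym k w v : dyadic k w v = dyadic k v w.
Proof. by rewrite /dyadic agree_sym. Qed.

Lemma dyadic_flip (i : 'I_n) w v : dyadic i w (flip i v) = dyadic i w v.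
Proof. by rewrite /dyadic agree_flipr. Qed.

Lemma dyadicD_flip (i : 'I_n) w v :
  dyadic i.+1 w v + dyadic i.+1 w (flip i v) = dyadic i w v *+ 2.
Proof.
rewrite !dyadicS dyadic_flip flip_eq.
by move: (dyadic i w v) => d; case: (w i) (v i) => [] [] /=; ring.
Qed.

Lemma dyadic_sum k w : (k <= n)%N -> \sum_v dyadic k w v = 1.
Proof.
elim: k => [_|k IHk kn].
  rewrite (eq_bigr (fun=> (2 ^+ n)^-1)) => [|v _]; last first.
    by rewrite /dyadic (_ : agree 0 w v) ?mulr1 ?div1r//; apply/agreeP.
  by rewrite sumr_const cardE -cardT card_cube -[_^-1 *+ _]mulr_natl natrX divff// expf_neq0.
pose i := Ordinal kn.
apply: (@mulIf _ 2) => //; rewrite !mulr_natr -(IHk (ltnW kn)).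
rewrite -(@sum_flip n _ predT _ i)// -sumrMnl; apply: eq_bigr => v _.
exact: (dyadicD_flip i).
Qed.

(** The factor passing from step [i] to the next is 0 or 2, at distance one from 1 in either
    case. *)
Lemma dyadic_diff (i : 'I_n) w v :
  `|dyadic i.+1 w v - dyadic i w v| = dyadic i w v.
Proof.
rewrite dyadicS -{2}[dyadic i w v]mulr1 -mulrBr normrM ger0_norm ?dyadic_ge0//.
case: (_ == _); rewrite ?mulr1 ?mulr0 ?sub0r ?normrN ?normr1 ?mulr1//.
by rewrite [2 - 1](_ : _ = 1) ?normr1 ?mulr1//; ring.
Qed.

(** A geometric sum: while [w] and [v] agree, the values are 2^i / 2^n. *)
Lemma dyadic_sum_lt k w v : agree k w v ->
  \sum_(i < k) dyadic i w v <= dyadic k w v.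
Proof.
elim: k => [|k IHk] wv; first by rewrite big_ord0 dyadic_ge0.
have wk := agree_le (leqnSn k) wv.
rewrite big_ord_recr/=; apply: le_trans (lerD (IHk wk) (lexx _)) _.
by rewrite /dyadic wv wk exprS; lra.
Qed.

(* For fixed w and v the sequence dyadic k w v doubles until it vanishes. *)
Lemma dyadic_max m w v : (0 < m)%N ->
  exists2 j, (j < m)%N & \sum_(i < m) dyadic i w v <= 2 * dyadic j w v.
Proof.
elim: m => // -[_ _|m /(_ isT)[j jm hj] _].
  by exists 0%N => //; rewrite big_ord1; have := dyadic_ge0 0 w v; lra.
(* Either the new term dominates the sum of all earlier ones, or it vanishes and the earlier maximum
   still serves. *)
rewrite big_ord_recr/=; have [wv|wv] := boolP (agree m.+1 w v).
  by exists m.+1 => //; have := dyadic_sum_lt wv; lra.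
exists j; first exact: ltnW.
by rewrite /dyadic (negbTE wv) mulr0 addr0.
Qed.

End DyadicMartingale.

(** * The dyadic martingale carried into X *)

Section DyadicMartingaleInX.
Variables (R : realType) (s : scalar_kind) (X : normedModType (scalars R s)).

Definition rcomb (I : finType) (x : I -> X) (c : I -> R) : X :=
  \sum_i of_real s (c i) *: x i.

Lemma eq_rcomb (I : finType) (x : I -> X) c d : c =1 d -> rcomb x c = rcomb x d.
Proof. by move=> cd; apply: eq_bigr => i _; rewrite cd. Qed.

Lemma rcombD (I : finType) (x : I -> X) c d :
  rcomb x c + rcomb x d = rcomb x (fun i => c i + d i).
Proof.
by rewrite -big_split; apply: eq_bigr => i _; rewrite /= of_realD scalerDl.
Qed.

Lemma rcombN (I : finType) (x : I -> X) c : - rcomb x c = rcomb x (fun i => - c i).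
Proof. by rewrite -sumrN; apply: eq_bigr => i _; rewrite of_realN scaleNr. Qed.

Lemma rcomb_sign (I : finType) (x : I -> X) c (b : bool) :
  (-1) ^+ b *: rcomb x c = rcomb x (fun i => (-1) ^+ b * c i).
Proof.
case: b; last by rewrite scale1r; apply: eq_rcomb => i; rewrite mul1r.
by rewrite scaleN1r rcombN; apply: eq_rcomb => i; rewrite mulN1r.
Qed.

Lemma rcomb_sum (I J : finType) (x : I -> X) (c : J -> I -> R) :
  \sum_j rcomb x (c j) = rcomb x (fun i => \sum_j c j i).
Proof.
rewrite exchange_big/=; apply: eq_bigr => i _.
rewrite -scaler_suml; congr (_ *: _).
by elim/big_rec2 : _ => [|j a b _ ->]; rewrite ?of_real0// of_realD.
Qed.

Lemma rnorm_rcomb_le (I : finType) (x : I -> X) c : (forall i, rnorm (x i) <= 1) ->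
  rnorm (rcomb x c) <= \sum_i `|c i|.
Proof.
move=> x1; apply: le_trans (rnorm_sum _ _ _) _; apply: ler_sum => i _.
by rewrite rnormZ rabs_of_real ler_piMr.
Qed.

Lemma rnorm_rcomb_ge (I : finType) (x : I -> X) c q : l1_lower_bound q x ->
  q * \sum_i `|c i| <= rnorm (rcomb x c).
Proof.
move=> /(_ (fun i => of_real s (c i))); congr (_ * _ <= _).
by apply: eq_bigr => i _; rewrite rabs_of_real.
Qed.

(** The family [x] embeds L_1 of the cube into X up to the factor [q], and [M] is the image of the
    densities, so every claim reduces to sums over [v] of moduli of real coefficients. *)
Lemma l1_large_martingale n (x : cube n -> X) (q : R) : (0 < n)%N -> 0 <= q ->
  (forall v, rnorm (x v) <= 1) -> l1_lower_bound q x ->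
  let M k w := rcomb x (dyadic R k w) in
  [/\ walsh_paley_martingale M,
      forall k w, (k <= n)%N -> rnorm (M k w) <= 1,
      forall (k : 'I_n) (w : cube n), q <= rnorm (mdiff M k w) &
      forall w, q / 2 * n%:R <= expect (fun e => rnorm (signed_sum M e w))].
Proof.
move=> n0 q0 x1 xq M.
have dM (k : 'I_n) w :
    mdiff M k w = rcomb x (fun v => dyadic R k.+1 w v - dyadic R k w v).
  by rewrite /mdiff rcombN rcombD.
have dM1 (k : 'I_n) (w : cube n) : \sum_v `|dyadic R k.+1 w v - dyadic R k w v| = 1.
  rewrite -(@dyadic_sum R n k w (ltnW (ltn_ord k))); apply: eq_bigr => v _.
  exact: dyadic_diff.
split.
- apply: walsh_paley_intro => [k w v kn wv|i w].
    apply: eq_rcomb => u; rewrite /dyadic; congr (_ * (nat_of_bool _)%:R).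
    by apply/idP/idP; apply: agree_trans => //; rewrite agree_sym.
  rewrite rcombD -[RHS]scaler_nat /rcomb scaler_sumr; apply: eq_bigr => v _.
  (* The flip acts on the martingale variable [w]; symmetry moves it to the second argument. *)
  rewrite [dyadic R _ w v]dyadic_sym [dyadic R _ (flip _ _) _]dyadic_sym dyadicD_flip dyadic_sym.
  by rewrite scaler_nat of_realMn scalerMnl.
- move=> k w kn; apply: le_trans (rnorm_rcomb_le _ x1) _.
  by under eq_bigr do rewrite ger0_norm ?dyadic_ge0//; rewrite dyadic_sum.
- by move=> k w; rewrite dM -[leLHS]mulr1 -(dM1 k w) rnorm_rcomb_ge.
move=> w.
pose d (k : 'I_n) v := dyadic R k.+1 w v - dyadic R k w v.
have sE e : signed_sum M e w = rcomb x (fun v => \sum_k (-1) ^+ e k * d k v).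
  by rewrite -rcomb_sum; apply: eq_bigr => k _; rewrite dM rcomb_sign.
pose S (e : cube n) := \sum_v q * `|\sum_k (-1) ^+ e k * d k v|.
apply: (@le_trans _ _ (expect S)); last first.
  by apply: le_expect => e; rewrite sE /S -mulr_sumr rnorm_rcomb_ge.
rewrite /S expect_sum.
(* Writing [n] as the total mass of the [n] densities makes it enough to compare at each [v]. *)
have -> : n%:R = \sum_v \sum_(k < n) dyadic R k w v.
  rewrite exchange_big/= (eq_bigr (fun=> 1)) ?sumr_const ?card_ord// => k _.
  by rewrite dyadic_sum// ltnW.
rewrite mulr_sumr; apply: ler_sum => v _; rewrite expectZ -mulrA ler_wpM2l//.
have [j jn hj] := dyadic_max R w v n0.
have := expect_sign_ge (fun k => d k v) (Ordinal jn).
rewrite dyadic_diff/= => /(le_trans _); apply.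
by rewrite ler_pdivrMl.
Qed.

Lemma large_martingale_of_l1n (theta : R) n : contains_l1n_uniformly X ->
  0 < theta -> (0 < n)%N ->
  exists M : nat -> cube n -> X,
    [/\ walsh_paley_martingale M,
        forall k w, (k <= n)%N -> rnorm (M k w) <= 1,
        forall (k : 'I_n) (w : cube n), 1 - theta <= rnorm (mdiff M k w) &
        forall w : cube n,
          4^-1 * n%:R <= expect (fun e => rnorm (signed_sum M e w))].
Proof.
(* The bound [1 - theta] controls the differences; the bound 1/2 gives [4^-1 <= q / 2] and keeps [q]
   positive when [theta >= 1]. *)
move=> Xl1 theta0 n0; pose q := Num.max (1 - theta) (2^-1).
have q2 : 2^-1 <= q by rewrite le_max lexx orbT.
have q01 : 0 < q < 1 by rewrite (lt_le_trans _ q2)// gt_max; apply/andP; split; lra.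
have [x [x1 xq]] := @james_distortion R s X (cube n) q Xl1 q01.
have [wpM M1 dM sM] := l1_large_martingale n0 (ltW (andP q01).1) x1 xq.
eexists; split; [exact: wpM|exact: M1| |] => [k w|w].
  by apply: le_trans (dM k w); rewrite le_max lexx.
by apply: le_trans (sM w); rewrite ler_wpM2r//; lra.
Qed.

End DyadicMartingaleInX.

(** * Changes of variables and Fubini for finite expectations *)

Lemma expect_bij (R : realType) (T T' : finType) (h : T' -> T) (f : T -> R) :
  bijective h -> expect f = expect (fun t => f (h t)).
Proof.
move=> hb; rewrite /expect (bij_eq_card hb); congr (_ * _).
by rewrite (reindex _ (onW_bij _ hb)).
Qed.

Lemma expect_inj (R : realType) (T : finType) (h : T -> T) (f : T -> R) :
  injective h -> expect (fun t => f (h t)) = expect f.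
Proof. by move=> /injF_bij hb; rewrite [RHS](expect_bij _ hb). Qed.

Lemma expect_exchange (R : realType) (T T' : finType) (f : T -> T' -> R) :
  expect (fun t => expect (f t)) = expect (fun t' => expect (f^~ t')).
Proof.
rewrite /expect -!mulr_sumr exchange_big/= mulrCA; congr (_ * (_ * _)).
Qed.

Lemma expect_pair (R : realType) (T T' : finType) (f : T * T' -> R) :
  expect f = expect (fun t => expect (fun t' => f (t, t'))).
Proof.
rewrite /expect card_prod natrM invfM -mulrA -mulr_sumr.
rewrite (pair_bigA _ (fun t t' => f (t, t')))/=; congr (_ * (_ * _)).
by apply: eq_bigr => -[].
Qed.

Lemma eq_expect (R : realType) (T : finType) (f g : T -> R) :
  f =1 g -> expect f = expect g.
Proof. by move=> fg; rewrite /expect (eq_bigr _ (fun t _ => fg t)). Qed.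

(** * Lower bound for [RUMD] *)

Section RUMDLower.
Variables (R : realType) (s : scalar_kind) (X : normedModType (scalars R s)).

(** Subtracting [M 0] leaves the differences unchanged and at most doubles the bound on the final
    value, whence the factor 1/2. *)
Lemma RUMD_ge n (alpha : R) (M : nat -> cube n -> X) : 0 <= alpha ->
  walsh_paley_martingale M -> (forall k w, (k <= n)%N -> rnorm (M k w) <= 1) ->
  (forall w, alpha * n%:R <= expect (fun e => rnorm (signed_sum M e w))) ->
  ((alpha / 2 * n%:R)%:E <= RUMD X n)%E.
Proof.
move=> alpha0 wpM M1 sM; apply: le_ereal_inf_tmp => _ [c [c0 hc] <-].
rewrite lee_fin; pose M' k w := M k w - M 0%N w.
have M0 k w v : agree k w v -> M 0%N w = M 0%N v.
  by move=> /(agree_le (leq0n k))/(walsh_paley_agree wpM); apply.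
have wpM' : walsh_paley_martingale M'.
  apply: walsh_paley_intro => [k w v kn wv|i w].
    by rewrite /M' (M0 _ _ _ wv) (walsh_paley_agree wpM kn wv).
  rewrite /M' (M0 0%N (flip i w) w); last first.
    by rewrite agree_sym agree_flip.
  by rewrite addrACA (walsh_paley_flip i w wpM) -opprD -mulr2n mulrnBl.
have /= := hc _ wpM' (fun w => subrr _).
set A := expect _; set B := expect _ => AB.
have B4 : Num.sqrt B <= 2.
  rewrite -[2]ger0_norm// -sqrtr_sqr ler_wsqrtr//.
  rewrite -[leRHS](@expect_cst _ (cube n)) ?card_cube_gt0//; apply: le_expect => w.
  rewrite lerXn2r ?nnegrE ?rnorm_ge0//; apply: le_trans (rnormB _ _) _.
  by have := M1 n w (leqnn _); have := M1 0%N w (leq0n _); lra.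
(* The L_2 norm dominates the L_1 norm; exchanging the expectations then leaves the average over
   signs at each fixed [w]. *)
have A1 : alpha * n%:R <= Num.sqrt A.
  rewrite -[leLHS]ger0_norm ?mulr_ge0// -sqrtr_sqr ler_wsqrtr//.
  apply: le_trans (sqr_expect_le _ _); last by rewrite card_prod muln_gt0 card_cube_gt0.
  apply: lerXn2r; rewrite ?nnegrE; first exact: mulr_ge0.
    by apply: expect_ge0 => t; exact: rnorm_ge0.
  rewrite expect_pair expect_exchange.
  rewrite -[leLHS](@expect_cst _ (cube n)) ?card_cube_gt0//; apply: le_expect => w.
  apply: le_trans (sM w) _; apply: le_expect => e /=.
  rewrite le_eqVlt; apply/orP; left; apply/eqP; congr rnorm.
  by apply: eq_bigr => k _; rewrite /mdiff /M' opprB addrA subrK.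
have := le_trans A1 AB; have : c * Num.sqrt B <= c * 2 by rewrite ler_pM2l.
lra.
Qed.

End RUMDLower.

(** * Submultiplicativity of the unimodular type constants *)

Lemma root_mulC sg p q : root_mul sg p q = root_mul sg q p.
Proof. by case: sg p q => [] [[] []] [[] []]. Qed.

Section UnimodularType.
Variables (R : realType) (s : scalar_kind) (X : normedModType (scalars R s)).
Variables (kappa : scalars R s) (sg : bool).
Hypotheses (kappa2 : kappa ^+ 2 = (-1) ^+ sg) (kappa1 : rabs kappa = 1).

Definition unimod_sum (I : finType) (z : {ffun I -> bool * bool}) (x : I -> X) : X :=
  \sum_i unimod kappa (z i) *: x i.

(* By Cauchy-Schwarz this always holds with t = 1. *)
Definition unimod_type (I : finType) (t : R) : Prop := forall x : I -> X,
  expect (fun z => rnorm (unimod_sum z x) ^+ 2)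
    <= t * #|I|%:R * \sum_i rnorm (x i) ^+ 2.

Definition ffun_root_mul (I : finType) (h z : {ffun I -> bool * bool}) :
  {ffun I -> bool * bool} := [ffun i => root_mul sg (h i) (z i)].

Lemma ffun_root_mulI (I : finType) (h : {ffun I -> bool * bool}) :
  injective (ffun_root_mul h).
Proof.
move=> z z' /ffunP e; apply/ffunP => i; have := e i.
by rewrite !ffunE; exact: root_mulI.
Qed.

Lemma ffun_root_mulC (I : finType) (h z : {ffun I -> bool * bool}) :
  ffun_root_mul h z = ffun_root_mul z h.
Proof. by apply/ffunP => i; rewrite !ffunE root_mulC. Qed.

Lemma roots_gt0 (I : finType) : (0 < #|{ffun I -> bool * bool}|)%N.
Proof. by rewrite card_ffun expn_gt0 card_prod card_bool. Qed.

(** A row of a uniform array is uniform: multiplying every row by a common [h] preserves the law,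
    and for fixed [z] averaging over [h] gives the uniform mean of [f]. *)
Lemma expect_marginal (I J : finType) (i : I) (f : {ffun J -> bool * bool} -> R) :
  expect (fun z : {ffun I * J -> bool * bool} => f [ffun j => z (i, j)]) = expect f.
Proof.
rewrite -[LHS](@expect_cst _ {ffun J -> bool * bool}) ?roots_gt0//.
transitivity (expect (fun h : {ffun J -> bool * bool} =>
    expect (fun z : {ffun I * J -> bool * bool} =>
      f (ffun_root_mul h [ffun j => z (i, j)])))).
  apply: eq_expect => h.
  rewrite -(@expect_inj _ _ (ffun_root_mul [ffun p => h p.2])); last first.
    exact: ffun_root_mulI.
  apply: eq_expect => z; congr f.
  by apply/ffunP => j; rewrite !ffunE.
rewrite expect_exchange -[RHS](@expect_cst _ {ffun I * J -> bool * bool}) ?roots_gt0//.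
apply: eq_expect => z.
rewrite -[RHS](expect_inj _ (@ffun_root_mulI _ [ffun j => z (i, j)])).
by apply: eq_expect => h; rewrite ffun_root_mulC.
Qed.

(** Multiplying row [i] by an independent root [h i] preserves the law of the array. The type
    inequality over [I] then applies to the row sums with [z] fixed, and the one over [J] to each
    row. *)
Lemma unimod_type_prod (I J : finType) (t u : R) : 0 <= t ->
  unimod_type I t -> unimod_type J u -> unimod_type (I * J)%type (t * u).
Proof.
move=> t0 hI hJ x.
pose block i (z : {ffun I * J -> bool * bool}) :=
  unimod_sum [ffun j => z (i, j)] (fun j => x (i, j)).
have -> : expect (fun z => rnorm (unimod_sum z x) ^+ 2) =
    expect (fun z => expect (fun h => rnorm (unimod_sum h (block^~ z)) ^+ 2)).
  rewrite expect_exchange -[LHS](@expect_cst _ {ffun I -> bool * bool}) ?roots_gt0//.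
  apply: eq_expect => h.
  rewrite -[LHS](@expect_inj _ _ (ffun_root_mul [ffun p => h p.1])); last first.
    exact: ffun_root_mulI.
  apply: eq_expect => z; congr (rnorm _ ^+ 2); rewrite /unimod_sum /block.
  rewrite (eq_bigr (fun p => unimod kappa
    (ffun_root_mul [ffun p => h p.1] z (p.1, p.2)) *: x (p.1, p.2))) => [|[]//].
  rewrite -(pair_bigA _ (fun i j =>
    unimod kappa (ffun_root_mul [ffun p => h p.1] z (i, j)) *: x (i, j)))/=.
  apply: eq_bigr => i _; rewrite scaler_sumr; apply: eq_bigr => j _.
  by rewrite !ffunE (unimodM _ _ kappa2) scalerA.
apply: le_trans (le_expect (fun z => hI (block^~ z))) _.
rewrite expectZ expect_sum card_prod natrM.
have -> : t * u * (#|I|%:R * #|J|%:R) * \sum_p rnorm (x p) ^+ 2 =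
    t * #|I|%:R * \sum_i (u * #|J|%:R * \sum_j rnorm (x (i, j)) ^+ 2).
  rewrite -mulr_sumr (pair_bigA _ (fun i j => rnorm (x (i, j)) ^+ 2))/=.
  rewrite (eq_bigr (fun p => rnorm (x (p.1, p.2)) ^+ 2)); first by ring.
  by case.
rewrite ler_wpM2l ?mulr_ge0//; apply: ler_sum => i _.
by rewrite (expect_marginal i (fun z => rnorm (unimod_sum z _) ^+ 2)) hJ.
Qed.

Lemma unimod_type_exp (I : finType) (t : R) : (0 < #|I|)%N -> 0 <= t ->
  unimod_type I t ->
  forall k, exists2 J : finType, (0 < #|J|)%N & unimod_type J (t ^+ k).
Proof.
move=> I0 t0 hI; elim=> [|k [J J0 hJ]].
  exists 'I_1 => [|x]; first by rewrite card_ord.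
  rewrite -[leRHS](@expect_cst _ {ffun 'I_1 -> bool * bool}) ?roots_gt0//.
  apply: le_expect => z; rewrite /unimod_sum !big_ord1 rnormZ (rabs_unimod _ kappa1).
  by rewrite card_ord !mul1r.
exists (I * J)%type; first by rewrite card_prod muln_gt0 I0.
by rewrite exprS; exact: unimod_type_prod.
Qed.

Lemma unimod_type_ord (I : finType) (t : R) :
  unimod_type I t -> unimod_type 'I_#|I| t.
Proof.
move=> hI x; have := hI (fun i => x (enum_rank i)); rewrite card_ord.
rewrite [in X in _ -> _ <= X](reindex _ (onW_bij _ (@enum_rank_bij I)))/=.
apply: le_trans; rewrite le_eqVlt; apply/orP; left; apply/eqP.
pose h (z : {ffun 'I_#|I| -> bool * bool}) : {ffun I -> bool * bool} :=
  [ffun i => z (enum_rank i)].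
have hb : bijective h.
  exists (fun z : {ffun I -> bool * bool} =>
    [ffun j : 'I_#|I| => z (enum_val j)]) => z; apply/ffunP => i.
    by rewrite !ffunE enum_valK.
  by rewrite !ffunE enum_rankK.
rewrite [RHS](expect_bij _ hb); apply: eq_expect => z; congr (rnorm _ ^+ 2).
rewrite /unimod_sum [LHS](reindex _ (onW_bij _ (@enum_rank_bij I)))/=.
by apply: eq_bigr => i _; rewrite ffunE.
Qed.

(** With the signs [e] fixed, averaging over the exponents of [kappa] gives mean
    [(1 + kappa) / 2 *: y]. By Jensen the mean square is at least |1 + kappa|^2 / 4 times |y|^2,
    hence at least half of |y|^2. *)
Lemma expect_sign_le_unimod n (x : 'I_n -> X) : 2 <= rabs (1 + kappa) ^+ 2 ->
  expect (fun e : cube n => rnorm (\sum_k (-1) ^+ e k *: x k) ^+ 2) <=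
  2 * expect (fun z => rnorm (unimod_sum z x) ^+ 2).
Proof.
move=> k12.
pose h (p : cube n * cube n) : {ffun 'I_n -> bool * bool} :=
  [ffun i => (p.1 i, p.2 i)].
have hb : bijective h.
  exists (fun z : {ffun 'I_n -> bool * bool} =>
    ([ffun i => (z i).1] : cube n, [ffun i => (z i).2] : cube n)) => [[e u]|z].
    by congr (_, _); apply/ffunP => i; rewrite !ffunE.
  by apply/ffunP => i; rewrite !ffunE; case: (z i).
rewrite (expect_bij _ hb) expect_pair -expectZ; apply: le_expect => e.
set y := \sum_k _; pose V (u : cube n) := \sum_k kappa ^+ u k *: ((-1) ^+ e k *: x k).
have VE u : unimod_sum (h (e, u)) x = V u.
  by apply: eq_bigr => k _; rewrite ffunE /unimod /= scalerA mulrC.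
under eq_expect do rewrite VE.
have sumV : (\sum_u V u) *+ 2 = (2 ^ n)%:R *: ((1 + kappa) *: y).
  rewrite /V exchange_big/= -sumrMnl scalerA scaler_sumr; apply: eq_bigr => k _.
  rewrite -scaler_suml scalerMnl -(@sum_flip n _ predT _ k)//; congr (_ *: _).
  rewrite (eq_bigr (fun=> 1 + kappa)) => [|u _]; last first.
    by rewrite flip_eq; case: (u k); rewrite ?expr0 ?expr1 // addrC.
  by rewrite sumr_const cardE -cardT card_cube mulr_natl.
have EV : rabs (1 + kappa) / 2 * rnorm y <= expect (fun u => rnorm (V u)).
  rewrite /expect card_cube ler_pdivlMl ?ltr0n ?expn_gt0//.
  have : rnorm ((\sum_u V u) *+ 2) <= (\sum_u rnorm (V u)) *+ 2.
    by rewrite rnormMn ler_pMn2r// rnorm_sum.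
  rewrite sumV !rnormZ rabs_nat mulr2n.
  lra.
have := sqr_expect_le (fun u => rnorm (V u)) (card_cube_gt0 n).
have : (rabs (1 + kappa) / 2 * rnorm y) ^+ 2 <= expect (fun u => rnorm (V u)) ^+ 2.
  apply: lerXn2r => //; rewrite nnegrE.
    by rewrite !mulr_ge0 ?rabs_ge0 ?rnorm_ge0.
  by apply: expect_ge0 => u; exact: rnorm_ge0.
move=> /le_trans/[apply]; set Z := expect _; set K := rabs _ in k12 *.
have -> : (K / 2 * rnorm y) ^+ 2 = K ^+ 2 * rnorm y ^+ 2 / 4 by field.
have : 0 <= (K ^+ 2 - 2) * rnorm y ^+ 2 by rewrite mulr_ge0 ?sqr_ge0 ?subr_ge0.
lra.
Qed.

End UnimodularType.

(** * Copies of l_1^n from extremal vectors *)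

Section L1FromUnimod.
Variables (R : realType) (s : scalar_kind) (X : normedModType (scalars R s)).

Definition l1_map n (z : 'I_n -> X) (a : 'rV[scalars R s]_n) : X :=
  \sum_i a ord0 i *: z i.

Lemma l1_map_is_linear n (z : 'I_n -> X) : linear (l1_map z).
Proof.
move=> c a b; rewrite /l1_map scaler_sumr -big_split/=.
by apply: eq_bigr => i _; rewrite !mxE scalerDl scalerA.
Qed.

HB.instance Definition _ n (z : 'I_n -> X) :=
  GRing.isLinear.Build (scalars R s) 'rV[scalars R s]_n X *:%R (l1_map z)
    (l1_map_is_linear z).

Lemma contains_l1n_intro (q : R) : 0 < q ->
  (forall n, (0 < n)%N -> exists y : 'I_n -> X,
    (forall i, rnorm (y i) <= 1) /\ l1_lower_bound q y) ->
  contains_l1n_uniformly X.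
Proof.
move=> q0 hq; have qV0 : 0 <= q^-1 by rewrite invr_ge0 ltW.
exists q^-1 => n n0; have [y [y1 hy]] := hq n n0.
exists (l1_map (fun i => of_real s q^-1 *: y i)) => a.
rewrite [X in rnorm X](_ : _ = of_real s q^-1 *: \sum_i a ord0 i *: y i); last first.
  rewrite scaler_sumr; apply: eq_bigr => i _.
  by rewrite !scalerA mulrC.
rewrite rnormZ rabs_ge0_of_real// ler_pdivlMl// (hy (fun i => a ord0 i))/=.
rewrite ler_wpM2l//; apply: le_trans (rnorm_sum _ _ _) _; apply: ler_sum => i _.
by rewrite rnormZ ler_piMr// rabs_ge0.
Qed.

Lemma sqr_sum_le n (r : 'I_n -> R) : (0 < n)%N ->
  (\sum_i r i) ^+ 2 <= n%:R * \sum_i r i ^+ 2.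
Proof.
move=> n0; have nR : 0 < n%:R :> R by rewrite ltr0n.
have := @sqr_expect_le _ 'I_n r; rewrite card_ord => /(_ n0).
rewrite /expect card_ord exprMn expr2 -mulrA ler_pM2l ?invr_gt0//.
by rewrite ler_pdivrMl.
Qed.

Variables (kappa : scalars R s).
Hypotheses (kappa1 : rabs kappa = 1).

(* The average of the norms |sum z_i x_i| is almost n, hence each of them is. *)
Lemma unimod_extremal n (eta : R) : (0 < n)%N -> 0 < eta -> eta * n%:R <= 1 / 8 ->
  ~ unimod_type X kappa 'I_n (1 - eta / #|{ffun 'I_n -> bool * bool}|%:R) ->
  exists (x : 'I_n -> X) (rho : R),
    [/\ 0 < rho, forall i, rho / 2 <= rnorm (x i),
        \sum_i rnorm (x i) <= n%:R * rho &
        forall z, (1 - eta) * (n%:R * rho) <= rnorm (unimod_sum kappa z x)].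
Proof.
move=> n0 eta0 etan; set N := #|_|.
have N0 : 0 < N%:R :> R by rewrite ltr0n roots_gt0.
have nR : 1 <= n%:R :> R by rewrite ler1n.
have eta1 : 0 < 1 - eta by nra.
move=> /existsNP[x /negP]; rewrite -ltNge card_ord.
set S := \sum_i _ => hx.
have S0 : 0 <= S by apply: sumr_ge0 => i _; exact: sqr_ge0.
have sumx : (\sum_i rnorm (x i)) ^+ 2 <= n%:R * S by exact: sqr_sum_le.
have sumx0 : 0 <= \sum_i rnorm (x i) by apply: sumr_ge0 => i _; exact: rnorm_ge0.
have usum_le z : rnorm (unimod_sum kappa z x) <= \sum_i rnorm (x i).
  apply: le_trans (rnorm_sum _ _ _) _; apply: ler_sum => i _.
  by rewrite rnormZ rabs_unimod// mul1r.
pose F (z : {ffun 'I_n -> bool * bool}) := rnorm (unimod_sum kappa z x) ^+ 2.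
have F_le z : F z <= n%:R * S.
  by apply: le_trans sumx; apply: lerXn2r; rewrite ?nnegrE ?rnorm_ge0.
(* All [N] terms are at most [n * S], so a deficit [eta / N] in the mean allows a single term a
   relative deficit of at most [eta]. *)
have F_ge z : (1 - eta) * (n%:R * S) <= F z.
  move: hx; rewrite /expect -/N ltr_pdivlMl// (bigD1 z)//= -/(F z).
  have : \sum_(i | i != z) rnorm (unimod_sum kappa i x) ^+ 2 <= (N%:R - 1) * (n%:R * S).
    apply: le_trans (ler_sum _ (fun i _ => F_le i)) _.
    rewrite sumr_const -[leLHS]mulr_natl ler_wpM2r ?mulr_ge0//.
    have : N = #|predC1 z|.+1 by rewrite cardC1 prednK// roots_gt0.
    by move=> ->; rewrite -natr1 addrK.
  have -> : N%:R * ((1 - eta / N%:R) * n%:R * S) = (N%:R - eta) * (n%:R * S).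
    by field; rewrite gt_eqF.
  lra.
have Sgt0 : 0 < S.
  rewrite lt_def S0 andbT; apply/negP => /eqP S00; move: hx.
  rewrite S00 mulr0 ltNge => /negP; apply.
  rewrite -[leRHS](@expect_cst _ {ffun 'I_n -> bool * bool}) ?roots_gt0//.
  by apply: le_expect => z; have := F_le z; rewrite S00 mulr0.
(* The quadratic mean of the norms of the [x i]. *)
pose rho := Num.sqrt (S / n%:R).
have rho0 : 0 < rho by rewrite sqrtr_gt0 divr_gt0// ltr0n.
have rho2 : S = n%:R * rho ^+ 2.
  by rewrite sqr_sqrtr ?divr_ge0// mulrC divfK// gt_eqF// ltr0n.
clearbody rho.
have sumx_le : \sum_i rnorm (x i) <= n%:R * rho.
  rewrite -ler_sqr ?nnegrE ?mulr_ge0 ?(ltW rho0)//.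
  apply: le_trans sumx _; rewrite rho2.
  have -> : n%:R * (n%:R * rho ^+ 2) = (n%:R * rho) ^+ 2 by ring.
  exact: lexx.
have usum_ge z : (1 - eta) * (n%:R * rho) <= rnorm (unimod_sum kappa z x).
  rewrite -ler_sqr ?nnegrE ?rnorm_ge0//; last first.
    by rewrite !mulr_ge0// ltW.
  apply: le_trans (F_ge z); rewrite rho2.
  have -> : ((1 - eta) * (n%:R * rho)) ^+ 2 = (1 - eta) * ((1 - eta) * (n%:R * rho) ^+ 2).
    by ring.
  have -> : n%:R * (n%:R * rho ^+ 2) = (n%:R * rho) ^+ 2 by ring.
  rewrite ler_pM2l// ler_piMl ?sqr_ge0//; lra.
exists x, rho; split => // i.
rewrite leNgt; apply/negP => xi.
(* The arithmetic mean of the norms nearly equals their quadratic mean, so they concentrate near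
   [rho]. As [2 * eta * n <= 1/4], none falls below [rho / 2]. *)
have var : \sum_j (rnorm (x j) - rho) ^+ 2 <= 2 * eta * n%:R * rho ^+ 2.
  have -> : \sum_j (rnorm (x j) - rho) ^+ 2 =
      S - 2 * rho * (\sum_j rnorm (x j)) + n%:R * rho ^+ 2.
    rewrite /S mulr_sumr -sumrB.
    have -> : n%:R * rho ^+ 2 = \sum_(j < n) rho ^+ 2.
      by rewrite sumr_const card_ord mulr_natl.
    by rewrite -big_split/=; apply: eq_bigr => j _; ring.
  have h := le_trans (usum_ge [ffun=> (false, false)]) (usum_le _).
  have : 0 <= rho * (\sum_i rnorm (x i) - (1 - eta) * (n%:R * rho)).
    by rewrite mulr_ge0 ?subr_ge0// ltW.
  rewrite rho2; lra.
have : (rnorm (x i) - rho) ^+ 2 <= 2 * eta * n%:R * rho ^+ 2.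
  apply: le_trans var; rewrite (bigD1 i)//= lerDl sumr_ge0// => j _.
  exact: sqr_ge0.
have : 2 * eta * n%:R * rho ^+ 2 <= 1 / 4 * rho ^+ 2.
  by rewrite ler_pM2r ?exprn_gt0//; lra.
have : (rho / 2) ^+ 2 < (rho - rnorm (x i)) ^+ 2.
  by rewrite ltr_sqr ?nnegrE; lra.
have -> : (rho / 2) ^+ 2 = 1 / 4 * rho ^+ 2 by field.
have -> : (rho - rnorm (x i)) ^+ 2 = (rnorm (x i) - rho) ^+ 2 by ring.
lra.
Qed.

Hypothesis rotation : forall a : scalars R s, exists p,
  rabs (a - of_real s (rabs a) * unimod kappa p) <= 4 / 5 * rabs a.

(** Since |sum z_i x_i| is almost maximal, lowering a common coefficient [m] to [a i <= m] loses no
    more than the triangle inequality allows, which leaves 9/10 of the l_1 norm. Replacing each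
    [b i] by its modulus times a nearby root costs 4/5, so 1/10 remains. *)
Lemma l1_of_unimod_extremal n (x : 'I_n -> X) (rho eta : R) :
  0 < rho -> 0 <= eta -> eta * n%:R <= 1 / 20 ->
  (forall i, rho / 2 <= rnorm (x i)) ->
  \sum_i rnorm (x i) <= n%:R * rho ->
  (forall z, (1 - eta) * (n%:R * rho) <= rnorm (unimod_sum kappa z x)) ->
  l1_lower_bound (1 / 10) (fun i => of_real s (rnorm (x i))^-1 *: x i).
Proof.
move=> rho0 eta0 etan x_ge sumx usum_ge b.
have xgt0 i : 0 < rnorm (x i) by apply: lt_le_trans (x_ge i); rewrite divr_gt0.
have [p hp] := choice (fun i => rotation (b i)).
pose z : {ffun 'I_n -> bool * bool} := [ffun i => p i].
set B := \sum_i rabs (b i).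
(* This dominates every [a i], because |b_i| <= B and |x_i| >= rho / 2. *)
pose m := 2 * B / rho.
pose a i := rabs (b i) / rnorm (x i).
have am i : a i <= m.
  rewrite /a /m ler_pdivrMr//.
  have bB : rabs (b i) <= B.
    by rewrite /B (bigD1 i)//= lerDl sumr_ge0// => j _; exact: rabs_ge0.
  apply: le_trans bB _.
  have {1}-> : B = 2 * B / rho * (rho / 2) by field; rewrite gt_eqF.
  rewrite ler_wpM2l// mulr_ge0 ?invr_ge0 ?(ltW rho0)// mulr_ge0//.
  by apply: sumr_ge0 => j _; exact: rabs_ge0.
have m0 : 0 <= m.
  rewrite mulr_ge0 ?invr_ge0 ?(ltW rho0)// mulr_ge0//.
  by apply: sumr_ge0 => j _; exact: rabs_ge0.
pose W := \sum_i (of_real s (a i) * unimod kappa (p i)) *: x i.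
have W_ge : 9 / 10 * B <= rnorm W.
  have mE : of_real s m *: unimod_sum kappa z x =
      W + \sum_i (of_real s (m - a i) * unimod kappa (p i)) *: x i.
    rewrite /W -big_split scaler_sumr; apply: eq_bigr => i _ /=.
    by rewrite -scalerDl -mulrDl -of_realD addrC subrK scalerA ffunE.
  have := rnormD W (\sum_i (of_real s (m - a i) * unimod kappa (p i)) *: x i).
  rewrite -mE rnormZ rabs_ge0_of_real// => h1.
  have h2 : rnorm (\sum_i (of_real s (m - a i) * unimod kappa (p i)) *: x i) <=
      m * (\sum_i rnorm (x i)) - B.
    apply: le_trans (rnorm_sum _ _ _) _.
    rewrite /B mulr_sumr -sumrB; apply: ler_sum => i _.
    rewrite rnormZ rabsM rabs_unimod// mulr1 rabs_ge0_of_real ?subr_ge0//.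
    by rewrite mulrBl /a divfK ?gt_eqF.
  have h3 : m * ((1 - eta) * (n%:R * rho)) <= m * rnorm (unimod_sum kappa z x).
    by rewrite ler_wpM2l.
  have h4 : m * \sum_i rnorm (x i) <= m * (n%:R * rho) by rewrite ler_wpM2l.
  have h5 : m * (eta * (n%:R * rho)) = 2 * (eta * n%:R) * B.
    by rewrite /m; field; rewrite gt_eqF.
  have h6 : 2 * (eta * n%:R) * B <= 1 / 10 * B.
    rewrite ler_wpM2r//; last lra.
    by apply: sumr_ge0 => j _; exact: rabs_ge0.
  lra.
have -> : \sum_i b i *: (of_real s (rnorm (x i))^-1 *: x i) = W +
    \sum_i (b i - of_real s (rabs (b i)) * unimod kappa (p i)) *:
      (of_real s (rnorm (x i))^-1 *: x i).
  rewrite /W -big_split; apply: eq_bigr => i _ /=.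
  rewrite /a of_realM !scalerA -scalerDl; congr (_ *: _); ring.
apply: le_trans (rnorm_subr _ _).
have : rnorm (\sum_i (b i - of_real s (rabs (b i)) * unimod kappa (p i)) *:
      (of_real s (rnorm (x i))^-1 *: x i)) <= 4 / 5 * B.
  apply: le_trans (rnorm_sum _ _ _) _; rewrite /B mulr_sumr; apply: ler_sum => i _.
  rewrite !rnormZ rabs_ge0_of_real ?invr_ge0 ?rnorm_ge0// mulVf ?gt_eqF// mulr1.
  exact: hp.
lra.
Qed.

Lemma contains_l1n_of_unimod :
  (forall n t, (0 < n)%N -> 0 < t < 1 -> ~ unimod_type X kappa 'I_n t) ->
  contains_l1n_uniformly X.
Proof.
move=> hX; apply: (@contains_l1n_intro (1 / 10)) => // n n0.
have nR : 1 <= n%:R :> R by rewrite ler1n.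
(* Then [eta * n = 1/20], small enough both for extremality and for the l_1 estimate. *)
pose eta : R := 1 / 20 / n%:R.
have eta0 : 0 < eta by rewrite !divr_gt0// ltr0n.
have etan : eta * n%:R = 1 / 20 by rewrite /eta divfK// gt_eqF// ltr0n.
have etan8 : eta * n%:R <= 1 / 8 by lra.
have t01 : 0 < 1 - eta / #|{ffun 'I_n -> bool * bool}|%:R < 1.
  have N1 : 1 <= #|{ffun 'I_n -> bool * bool}|%:R :> R by rewrite ler1n roots_gt0.
  have N0 := lt_le_trans ltr01 N1.
  rewrite subr_gt0 ltr_pdivrMr// mul1r gtrBl divr_gt0// andbT.
  by apply: lt_le_trans N1; nra.
have [x [rho [rho0 x_ge sumx usum_ge]]] := unimod_extremal n0 eta0 etan8 (hX n _ n0 t01).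
exists (fun i => of_real s (rnorm (x i))^-1 *: x i); split => [i|].
  rewrite rnormZ rabs_ge0_of_real ?invr_ge0 ?rnorm_ge0// mulVf// gt_eqF//.
  by apply: lt_le_trans (x_ge i); rewrite divr_gt0.
apply: (l1_of_unimod_extremal rho0 (ltW eta0)) x_ge sumx usum_ge.
by rewrite etan.
Qed.

End L1FromUnimod.

(** * Upper bound for [RUMD] and its consequence *)

Section RUMDUpper.
Variables (R : realType) (s : scalar_kind) (X : normedModType (scalars R s)).

(** Apply the type inequality to the differences at each [w]. The 8 is 2, for passing from signs to
    roots, times 4, from E|dM_k|^2 <= 4 E|M_n|^2. *)
Lemma RUMD_le n (kappa : scalars R s) (t : R) : (0 < n)%N -> 0 < t ->
  2 <= rabs (1 + kappa) ^+ 2 -> unimod_type X kappa 'I_n t ->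
  (RUMD X n <= (Num.sqrt (8 * t) * n%:R)%:E)%E.
Proof.
move=> n0 t0 k12 hX; have nR : 0 < n%:R :> R by rewrite ltr0n.
apply: ge_ereal_inf; exists (Num.sqrt (8 * t) * n%:R)%:E => //.
exists (Num.sqrt (8 * t) * n%:R) => //; split.
  by rewrite mulr_gt0// sqrtr_gt0 mulr_gt0.
move=> M wpM _; set B := expect (fun w => rnorm (M n w) ^+ 2).
have B0 : 0 <= B by apply: expect_ge0 => w; exact: sqr_ge0.
have EM k : (k <= n)%N -> expect (fun w => rnorm (M k w) ^+ 2) <= B.
  move=> kn; rewrite ler_pM2l ?invr_gt0 ?ltr0n ?card_cube_gt0//.
  exact: walsh_paley_rnorm.
have EdM (k : 'I_n) : expect (fun w => rnorm (mdiff M k w) ^+ 2) <= 4 * B.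
  apply: (@le_trans _ _ (expect (fun w =>
      (* The double minus presents the sum as a difference, to fit [expectB]. *)
      2 * rnorm (M k.+1 w) ^+ 2 - - 2 * rnorm (M k w) ^+ 2))).
    apply: le_expect => w; have := rnormB (M k.+1 w) (M k w).
    have := rnorm_ge0 (mdiff M k w); rewrite -/(mdiff M k w).
    move: (rnorm (mdiff M k w)) (rnorm (M k.+1 w)) (rnorm (M k w)) => a b c a0 abc.
    have : a ^+ 2 <= (b + c) ^+ 2 by rewrite lerXn2r// nnegrE (le_trans a0 abc).
    have := sqr_ge0 (b - c); rewrite !expr2; lra.
  rewrite expectB !expectZ; have := EM k (ltnW (ltn_ord k)).
  by have := EM k.+1 (ltn_ord k); lra.
have -> : Num.sqrt (8 * t) * n%:R * Num.sqrt B = Num.sqrt (8 * t * n%:R ^+ 2 * B).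
  have t8 : 0 <= 8 * t by rewrite mulr_ge0// ltW.
  rewrite [in RHS]sqrtrM; last by rewrite mulr_ge0// sqr_ge0.
  by rewrite [in RHS](sqrtrM (n%:R ^+ 2) t8) sqrtr_sqr ger0_norm.
apply: ler_wsqrtr; rewrite expect_pair expect_exchange.
apply: (@le_trans _ _ (expect (fun w =>
    2 * (t * n%:R * \sum_k rnorm (mdiff M k w) ^+ 2)))).
  apply: le_expect => w /=; apply: le_trans (expect_sign_le_unimod _ k12) _.
  by rewrite ler_pM2l//; have := hX (fun k => mdiff M k w); rewrite card_ord.
rewrite !expectZ expect_sum.
have : \sum_(k < n) expect (fun w => rnorm (mdiff M k w) ^+ 2) <= n%:R * (4 * B).
  apply: le_trans (ler_sum _ (fun k _ => EdM k)) _.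
  by rewrite sumr_const card_ord -[leLHS]mulr_natl.
move=> h; have tn0 : 0 <= 2 * t * n%:R by rewrite !mulr_ge0// ltW.
have := ler_wpM2l tn0 h.
by rewrite expr2; lra.
Qed.

Lemma contains_l1n_of_RUMD (c : R) : 0 < c ->
  (forall n, (0 < n)%N -> ((c * n%:R)%:E <= RUMD X n)%E) ->
  contains_l1n_uniformly X.
Proof.
move=> c0 hc.
have [kappa [sg [kappa2 kappa1 kappa12 rotation]]] := exists_rotation R s.
apply: (contains_l1n_of_unimod kappa1 rotation) => n t n0 /andP[t0 t1] hX.
have n0' : (0 < #|'I_n|)%N by rewrite card_ord.
(* The threshold makes [Num.sqrt (8 * t ^+ k) < c], against the lower bound on [RUMD] at [#|J|]. *)
have [k tk] : exists k, t ^+ k < c ^+ 2 / 8.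
  by apply: exists_expr_lt; rewrite ?ltW// divr_gt0// exprn_gt0.
have [J J0 /unimod_type_ord hJ] := unimod_type_exp kappa2 kappa1 n0' (ltW t0) hX k.
have := le_trans (hc _ J0) (RUMD_le J0 (exprn_gt0 k t0) kappa12 hJ).
rewrite lee_fin ler_pM2r ?ltr0n// leNgt => /negP; apply.
rewrite -[ltRHS]gtr0_norm// -sqrtr_sqr ltr_sqrt ?exprn_gt0//.
lra.
Qed.

End RUMDUpper.

(** * The cycle of implications *)

Theorem theorem3p5 (R : realType) :
  exists alpha : R, 0 < alpha /\
  forall (s : scalar_kind) (X : completeNormedModType (scalars R s)),
    let not_K_convex := ~ K_convex X in
    let large_martingales :=
      forall (theta : R) (n : nat), 0 < theta -> (0 < n)%N ->
      exists M : nat -> cube n -> X,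
        [/\ walsh_paley_martingale M,
            forall k w, (k <= n)%N -> rnorm (M k w) <= 1,
            forall (k : 'I_n) (w : cube n), 1 - theta <= rnorm (mdiff M k w) &
            forall w : cube n,
              alpha * n%:R <= expect (fun e => rnorm (signed_sum M e w))] in
    let RUMD_maximal :=
      exists c : R, 0 < c /\
      forall n : nat, (0 < n)%N -> ((c * n%:R)%:E <= RUMD X n)%E in
    (not_K_convex <-> large_martingales) /\
    (large_martingales <-> RUMD_maximal).
Proof.
exists 4^-1; split=> [|s X /=]; first by rewrite invr_gt0.
set P1 := ~ K_convex X; set P2 := (X in P1 <-> X); set P3 := (X in P2 <-> X).
have P12 : P1 -> P2.
  by move=> /contrapT Xl1 theta n; exact: large_martingale_of_l1n.
have P23 : P2 -> P3.
  move=> hM; exists (4^-1 / 2); split=> [|n n0]; first by rewrite divr_gt0// invr_gt0.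
  have [M [wpM M1 _ sM]] := hM 1 n ltr01 n0.
  by apply: RUMD_ge wpM M1 sM; rewrite invr_ge0.
have P31 : P3 -> P1.
  by move=> [c [c0 hc]]; apply; exact: contains_l1n_of_RUMD hc.
by split; split; auto.
Qed.
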